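(* Let $(M,\mathcal F,g_\intercal)$ be a transversely time-oriented Lorentzian foliation. (i) If the transverse Seifert condition holds on $(M,\mathcal F,g_\intercal)$ and the transverse Seifert relation $J^+_{S\intercal}$ is closed, then $(M,\mathcal F,g_\intercal)$ is transversely $K$-causal. (ii) If $(M,\mathcal F,g_\intercal)$ is transversely stably causal, then the transverse Seifert relation is antisymmetric. In particular, the transverse Seifert condition holds.
   Context: $M$ is a connected smooth manifold of dimension $n\ge 3$. $\mathcal F$ is a regular foliation of codimension $q\geq 2$: a partition of $M$ into connected immersed submanifolds (leaves), locally given by the fibers of a submersion. $T\mathcal F\subset TM$ is the (vertical) distribution tangent to the leaves; vectors in $T\mathcal F$, and vector fields with values in it, are called vertical. $M/\mathcal F$ is the leaf space with the quotient topology. A transverse Lorentzian metric on $(M,\mathcal F)$ is a smooth symmetric $(0,2)$-tensor field $g_\intercal$ on $M$ with $\mathcal L_Vg_\intercal=0$ for all vertical $V$, such that at each $x$ the bilinear form $g_\intercal(x)$ has index $1$ and its kernel is exactly $T_x\mathcal F$. $\mathcal{TL}(M,\mathcal F)$ is the set of these. The triple $(M,\mathcal F,g_\intercal)$ is then called a Lorentzian foliation. A nonvertical vector $v$ is transversely causal if $g_\intercal(v,v)\le 0$. The set of transversely causal vectors at $x$ has two connected components (causal wedges); a transverse time orientation is a continuous choice of one of them (the future causal wedge) at each point. A future-directed transversely causal curve is a piecewise smooth curve whose tangent vectors lie in the future causal wedges. For leaves $L,L'$, write $L<_{M/\mathcal F}L'$ if there is a future-directed transversely causal curve from a point of $L$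 to a point of $L'$, and $L\le_{M/\mathcal F}L'$ if $L<_{M/\mathcal F}L'$ or $L=L'$. $J^+_{M/\mathcal F}=J^+_{M/\mathcal F,g_\intercal}:=\{(L,L'):L\le_{M/\mathcal F}L'\}\subset M/\mathcal F\times M/\mathcal F$. $(M,\mathcal F,g_\intercal)$ is transversely causal if $L\nless_{M/\mathcal F}L$ for every leaf $L$. For $g_\intercal,g'_\intercal\in\mathcal{TL}(M,\mathcal F)$, write $g_\intercal<g'_\intercal$ if for every $v\in TM\setminus T\mathcal F$, $g_\intercal(v,v)\le0\Rightarrow g'_\intercal(v,v)<0$; in that case $g'_\intercal$ is time-oriented so that its future wedges contain those of $g_\intercal$. $(M,\mathcal F,g_\intercal)$ is transversely stably causal if there is $g'_\intercal\in\mathcal{TL}(M,\mathcal F)$ with $g_\intercal<g'_\intercal$ and $(M,\mathcal F,g'_\intercal)$ transversely causal. Transverse Seifert relation: $J^+_{S\intercal}:=\bigcap_{g'_\intercal>g_\intercal}J^+_{M/\mathcal F,g'_\intercal}$, the intersection over transverse Lorentzian metrics $g'_\intercal$ with $g_\intercal<g'_\intercal$. Transverse $K^+$ relation $K^+_\intercal$: the smallest closed (in the product topology of $M/\mathcal F\times M/\mathcal F$) and transitive relation on $M/\mathcal F$ containing $J^+_{M/\mathcal F}$. $\overline{\Delta_{M/\mathcal F}}$ is the closure of the diagonal in $M/\mathcal F\times M/\mathcal F$. Transversely $K$-causal: $(\hat x,\hat y),(\hat y,\hat x)\in K^+_\intercal$ implies $(\hat x,\hat y)\in\overline{\Delta_{M/\mathcal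 F}}$. Transverse Seifert condition: $(\hat x,\hat y),(\hat y,\hat x)\in J^+_{S\intercal}$ implies $(\hat x,\hat y)\in\overline{\Delta_{M/\mathcal F}}$. Antisymmetric (for a relation $R$): $(\hat x,\hat y),(\hat y,\hat x)\in R$ implies $\hat x=\hat y$. *)

(* Defs.v *)
From HB Require Import structures.
From mathcomp Require Import all_boot all_order all_algebra generic_quotient.
From mathcomp Require Import all_classical all_reals all_analysis.
Set Implicit Arguments.
Unset Strict Implicit.
Unset Printing Implicit Defensive.
Import Order.TTheory GRing.Theory Num.Theory.
Import numFieldNormedType.Exports.
Local Open Scope classical_set_scope.
Local Open Scope ring_scope.
Local Open Scope quotient_scope.

Fixpoint Ck (R : realType) (V W : normedModType R) (k : nat) (U : set V)
    (f : V -> W) : Prop :=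
  match k with
  | 0%N => forall x, U x -> {for x, continuous f}
  | k'.+1 => (forall x, U x -> differentiable f x) /\
             (forall v : V, Ck k' U ('D_v f))
  end.

(* Meaningful for open [U]. *)
Definition smooth_on (R : realType) (V W : normedModType R) (U : set V)
    (f : V -> W) : Prop := forall k, Ck k U f.

(** * Smooth manifolds *)

(* The values of [cmap] outside [dom], and of [cinv] outside the image of
   [dom], are irrelevant. *)
Record chart (R : realType) (M : topologicalType) (n : nat) := Chart {
  dom : set M;
  cmap : M -> 'rV[R]_n;
  cinv : 'rV[R]_n -> M;
  dom_open : open dom;
  image_open : open (cmap @` dom);
  cmapK : forall x, dom x -> cinv (cmap x) = x;
  cmap_cont : forall x, dom x -> {for x, continuous cmap};
  cinv_cont : forall z, (cmap @` dom) z -> {for z, continuous cinv} }.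

Definition transition (R : realType) (M : topologicalType) (n : nat)
    (c d : chart R M n) : 'rV[R]_n -> 'rV[R]_n := cmap d \o cinv c.

Definition compatible (R : realType) (M : topologicalType) (n : nat)
    (c d : chart R M n) : Prop :=
  smooth_on (cmap c @` (dom c `&` dom d)) (transition c d) /\
  smooth_on (cmap d @` (dom c `&` dom d)) (transition d c).

Record smooth_manifold (R : realType) (n : nat) := SmoothManifold {
  mcarrier :> topologicalType;
  mhausdorff : hausdorff_space mcarrier;
  msecond_countable : @second_countable mcarrier;
  atlas : set (chart R mcarrier n);
  atlas_cover : forall x, exists2 c, atlas c & dom c x;
  atlas_compatible : forall c d, atlas c -> atlas d -> compatible c d;
  atlas_maximal : forall c, (forall d, atlas d -> compatible c d) -> atlas c }.

(* Jacobian at [x] of the change of coordinates from [c] to [d].  Vectors are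
   rows: [v] in the chart [c] reads [v *m chart_jac c d x] in the chart [d]. *)
Definition chart_jac (R : realType) (n : nat) (M : smooth_manifold R n)
    (c d : chart R M n) (x : M) : 'M[R]_n :=
  'J (transition c d) (cmap c x).

Definition smooth_map (R : realType) (m n : nat) (N : smooth_manifold R m)
    (M : smooth_manifold R n) (f : N -> M) : Prop :=
  continuous f /\
  forall (e : chart R N m) (c : chart R M n), atlas e -> atlas c ->
    smooth_on (cmap e @` (dom e `&` f @^-1` dom c)) (cmap c \o f \o cinv e).

(* Matrix of the differential of [f] at [a]; it acts on row vectors. *)
Definition map_jac (R : realType) (m n : nat) (N : smooth_manifold R m)
    (M : smooth_manifold R n) (f : N -> M) (e : chart R N m) (c : chart R M n)
    (a : N) : 'M[R]_(m, n) :=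
  'J (cmap c \o f \o cinv e) (cmap e a).

Definition immersion (R : realType) (m n : nat) (N : smooth_manifold R m)
    (M : smooth_manifold R n) (f : N -> M) : Prop :=
  smooth_map f /\
  forall e c a, atlas e -> atlas c -> dom e a -> dom c (f a) ->
    row_free (map_jac f e c a).

(* [f] exhibits [L] as a connected immersed submanifold of [M]. *)
Definition immersed_param (R : realType) (m n : nat) (N : smooth_manifold R m)
    (M : smooth_manifold R n) (f : N -> M) (L : set M) : Prop :=
  [/\ connected [set: N], immersion f, injective f & range f = L].

Definition smooth_curve (R : realType) (n : nat) (M : smooth_manifold R n)
    (O : set R) (gam : R -> M) : Prop :=
  (forall t, O t -> {for t, continuous gam}) /\
  forall c, atlas c -> smooth_on (O `&` gam @^-1` dom c) (cmap c \o gam).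

(** * Foliations *)

Section Foliation.
Variables (R : realType) (p q : nat) (M : smooth_manifold R (p + q)).

(* Flat chart of a partition of [M]: its image is a box, and every class meets
   its domain in a countable union of fibers of the submersion given by the last
   [q] coordinates. *)
Definition flat_chart (leaf : rel M) (c : chart R M (p + q)) : Prop :=
  [/\ atlas c,
      exists a b : 'rV[R]_(p + q),
        cmap c @` dom c = [set z | forall i, a 0 i < z 0 i < b 0 i]
    & forall x, exists2 C : set 'rV[R]_q, countable C &
        forall y, dom c y -> (leaf x y <-> C (rsubmx (cmap c y)))].

Record foliation := Foliation {
  leaf : equiv_rel M;
  leaf_immersed : forall x, exists (N : smooth_manifold R p) (f : N -> M),
    immersed_param f [set y | leaf x y];
  leaf_flat : forall x, exists2 c, flat_chart leaf c & dom c x }.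

Variable F : foliation.

(* Leaf space, with the quotient topology. *)
Definition leaf_space : topologicalType :=
  quotient_topology {eq_quot leaf F}.

Definition leaf_of (x : M) : leaf_space := \pi_({eq_quot leaf F}) x.

(* [v] is the expression in the chart [c] of a vector tangent at [x] to the leaf
   through [x]. *)
Definition vertical (c : chart R M (p + q)) (x : M) (v : 'rV[R]_(p + q)) : Prop :=
  exists (N : smooth_manifold R p) (f : N -> M) (e : chart R N p) (a : N)
      (w : 'rV[R]_p),
    [/\ immersed_param f [set y | leaf F x y], atlas e, dom e a, f a = x
      & v = w *m map_jac f e c a].

(** * Transverse Lorentzian metrics *)

(* Vector fields (here on an open set [O]) and (0,2)-tensor fields are given by
   their components in the charts, subject to the transformation law. *)
Definition vertical_field (O : set M)
    (V : chart R M (p + q) -> M -> 'rV[R]_(p + q)) : Prop :=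
  [/\ forall c d x, atlas c -> atlas d -> O x -> dom c x -> dom d x ->
        V d x = V c x *m chart_jac c d x,
      forall c, atlas c ->
        smooth_on (cmap c @` (O `&` dom c)) (V c \o cinv c)
    & forall c x, atlas c -> O x -> dom c x -> vertical c x (V c x)].

Definition tensor02 (g : chart R M (p + q) -> M -> 'M[R]_(p + q)) : Prop :=
  (forall c d x, atlas c -> atlas d -> dom c x -> dom d x ->
     g c x = chart_jac c d x *m g d x *m (chart_jac c d x)^T) /\
  (forall c, atlas c -> smooth_on (cmap c @` dom c) (g c \o cinv c)).

(* Components
   (L_V g)_ij = V^k d_k g_ij + (d_i V^k) g_kj + g_ik (d_j V^k). *)
Definition lie_derivative (V : chart R M (p + q) -> M -> 'rV[R]_(p + q))
    (g : chart R M (p + q) -> M -> 'M[R]_(p + q))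
    (c : chart R M (p + q)) (x : M) : 'M[R]_(p + q) :=
  let z := cmap c x in
  let DV := 'J (V c \o cinv c) z in
  'D_(V c x) (g c \o cinv c) z + DV *m g c x + g c x *m DV^T.

Definition bform n (G : 'M[R]_n) (v w : 'rV[R]_n) : R := (v *m G *m w^T) 0 0.

(* Dimension of a maximal negative definite subspace; the rows of [A] span the
   subspace. *)
Definition has_index n (G : 'M[R]_n) (k : nat) : Prop :=
  let negdef m (A : 'M[R]_(m, n)) :=
    row_free A /\ forall u, u != 0 -> bform G (u *m A) (u *m A) < 0 in
  (exists A : 'M[R]_(k, n), negdef k A) /\
  (forall m (A : 'M[R]_(m, n)), negdef m A -> (m <= k)%N).

Record transverse_metric := TransverseMetric {
  metric : chart R M (p + q) -> M -> 'M[R]_(p + q);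
  metric_tensor : tensor02 metric;
  metric_symmetric : forall c x, atlas c -> dom c x -> (metric c x)^T = metric c x;
  metric_lie : forall O V, open O -> vertical_field O V ->
    forall c x, atlas c -> O x -> dom c x -> lie_derivative V metric c x = 0;
  metric_index : forall c x, atlas c -> dom c x -> has_index (metric c x) 1%N;
  metric_ker : forall c x v, atlas c -> dom c x ->
    ((forall w, bform (metric c x) v w = 0) <-> vertical c x v) }.

Definition tcausal (g : transverse_metric) (c : chart R M (p + q)) (x : M) :
    set 'rV[R]_(p + q) :=
  [set v | ~ vertical c x v /\ bform (metric g c x) v v <= 0].

(** * Time orientations and the causal relations *)

(* [wedge c x] is the future causal wedge at [x], read in the chart [c].
   Continuity: around each point there is a continuous vector field with values
   in the chosen wedges. *)
Record time_orientation (g : transverse_metric) := TimeOrientation {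
  wedge : chart R M (p + q) -> M -> set 'rV[R]_(p + q);
  wedge_component : forall c x, atlas c -> dom c x ->
    exists2 v, tcausal g c x v &
      wedge c x = connected_component (tcausal g c x) v;
  wedge_chart : forall c d x, atlas c -> atlas d -> dom c x -> dom d x ->
    wedge d x = [set v *m chart_jac c d x | v in wedge c x];
  wedge_cont : forall c x, atlas c -> dom c x ->
    exists (O : set M) (X : M -> 'rV[R]_(p + q)),
      [/\ open O, O x, O `<=` dom c &
          forall y, O y -> {for y, continuous X} /\ wedge c y (X y)] }.

(* Smooth on [[s, t]] means restriction of a smooth curve on an open
   neighborhood, so the velocities at [s] and [t] are one-sided ones of [gam]. *)
Definition future_causal_arc (g : transverse_metric) (T : time_orientation g)
    (gam : R -> M) (s t : R) : Prop :=
  exists (O : set R) (del : R -> M),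
    [/\ open O, `[s, t] `<=` O, smooth_curve O del,
        {in `[s, t], gam =1 del}
      & forall u c, u \in `[s, t] -> atlas c -> dom c (del u) ->
          wedge T c (del u) ('D_1 (cmap c \o del) u)].

Definition future_causal_curve (g : transverse_metric) (T : time_orientation g)
    (gam : R -> M) (a b : R) : Prop :=
  [/\ a < b, {within `[a, b], continuous gam} &
      exists s : seq R,
        [/\ path <%R a s, last a s = b &
            forall i, (i < size s)%N ->
              future_causal_arc T gam (nth a (a :: s) i) (nth a s i)]].

Definition leaf_lt (g : transverse_metric) (T : time_orientation g)
    (L L' : leaf_space) : Prop :=
  exists (gam : R -> M) (a b : R),
    [/\ future_causal_curve T gam a b, leaf_of (gam a) = L
      & leaf_of (gam b) = L'].

Definition Jplus (g : transverse_metric) (T : time_orientation g) :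
    set (leaf_space * leaf_space) :=
  [set LL | leaf_lt T LL.1 LL.2 \/ LL.1 = LL.2].

Definition transversely_causal (g : transverse_metric)
    (T : time_orientation g) : Prop :=
  forall L, ~ leaf_lt T L L.

Definition metric_lt (g g' : transverse_metric) : Prop :=
  forall c x v, atlas c -> dom c x -> ~ vertical c x v ->
    bform (metric g c x) v v <= 0 -> bform (metric g' c x) v v < 0.

Definition wider_orientation (g g' : transverse_metric)
    (T : time_orientation g) (T' : time_orientation g') : Prop :=
  forall c x, atlas c -> dom c x -> wedge T c x `<=` wedge T' c x.

(* If [metric_lt g g'], exactly one time orientation of [g'] (up to its values
   outside the domains of charts) is wider than [T], so quantifying over [T']
   below amounts to using that one. *)
Definition stably_causal (g : transverse_metric) (T : time_orientation g) : Prop :=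
  exists (g' : transverse_metric) (T' : time_orientation g'),
    [/\ metric_lt g g', wider_orientation T T' & transversely_causal T'].

Definition Jseifert (g : transverse_metric) (T : time_orientation g) :
    set (leaf_space * leaf_space) :=
  [set LL | forall (g' : transverse_metric) (T' : time_orientation g'),
     metric_lt g g' -> wider_orientation T T' -> Jplus T' LL].

Definition transitive_rel (A : set (leaf_space * leaf_space)) : Prop :=
  forall x y z, A (x, y) -> A (y, z) -> A (x, z).

Definition antisymmetric_rel (A : set (leaf_space * leaf_space)) : Prop :=
  forall x y, A (x, y) -> A (y, x) -> x = y.

Definition Kplus (g : transverse_metric) (T : time_orientation g) :
    set (leaf_space * leaf_space) :=
  \bigcap_(A in [set A | [/\ closed A, transitive_rel A & Jplus T `<=` A]]) A.

Definition closed_diagonal : set (leaf_space * leaf_space) :=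
  closure [set LL | LL.1 = LL.2].

Definition K_causal (g : transverse_metric) (T : time_orientation g) : Prop :=
  forall x y, Kplus T (x, y) -> Kplus T (y, x) -> closed_diagonal (x, y).

Definition seifert_condition (g : transverse_metric) (T : time_orientation g) :
    Prop :=
  forall x y, Jseifert T (x, y) -> Jseifert T (y, x) -> closed_diagonal (x, y).

End Foliation.

(* Main.v *)
(* The point is that the relation [<_{M/F}] is transitive for every transverse
   metric; this is not immediate, since consecutive curves need only end and
   start on a common leaf. In a flat chart the metric depends on the transverse
   coordinates only, because its Lie derivatives along the coordinate vertical
   fields vanish, and by continuity so do the future wedges, which are moreover
   invariant under adding vertical vectors. Hence the end point of a causal curve
   can be moved inside its plaque by adding a vertical ramp to the curve, and
   along the whole leaf because leaves are connected. It follows that the Seifert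
   relation is transitive; as it contains [J^+], it contains [K^+] when it is
   closed, which gives (i). For (ii), two distinct leaves related both ways would
   give [L < L] for the wider, transversely causal metric. *)
Require Import Defs.
From HB Require Import structures.
From mathcomp Require Import all_boot all_order all_algebra generic_quotient.
From mathcomp Require Import all_classical all_reals all_analysis.
From mathcomp Require Import lra.
Set Implicit Arguments.
Unset Strict Implicit.
Unset Printing Implicit Defensive.
Import Order.TTheory GRing.Theory Num.Theory.
Import numFieldNormedType.Exports.
Local Open Scope classical_set_scope.
Local Open Scope ring_scope.

(** * Calculus of C^k maps *)

(** The first-order expansion at [x] sees only the germ of the map, so the differential of [f]
    serves for [g]. Identities valid only inside a chart domain can thus be used under
    derivatives. *)
Lemma near_eq_differentiable (R : numFieldType) (V W : normedModType R)
    (f g : V -> W) (x : V) :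
  {near x, f =1 g} -> differentiable f x -> differentiable g x.
Proof.
move=> fg df.
have gE : g \o shift x = cst (g x) + 'd f x +o_ 0 id.
  apply/eqaddoP => _/posnumP[e].
  have /eqaddoP/(_ e%:num) /(_ [gt0 of e%:num]) := diff_locally df.
  apply: filter_app.
  have fg0 : \forall y \near 0, f (y + x) = g (y + x).
    by move: fg; rewrite (near_shift 0) subr0.
  near=> y => /=.
  rewrite !fctE /=.
  by rewrite (near fg0)// (nbhs_singleton fg).
have dgE : 'd g x = 'd f x :> (V -> W).
  by apply: diff_unique => //; exact: diff_continuous.
apply/diff_locallyP; rewrite dgE; split=> //; exact: diff_continuous.
Unshelve. all: by end_near. Qed.

Section smooth_calculus.
Variable R : realType.
Implicit Types U V W : normedModType R.

(** Scaling is a continuous bilinear map, so the product rule is the chain rule through the pair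
    [(a, f)]. *)
Lemma differentiable_scale V W (a : V -> R) (f : V -> W) x :
  differentiable a x -> differentiable f x ->
  differentiable (fun y => a y *: f y) x /\
  forall v, 'd (fun y => a y *: f y) x v = a x *: 'd f x v + 'd a x v *: f x.
Proof.
move=> da df.
have Bbilin : bilinear_for (GRing.Scale.Law.clone _ _ *:%R _)
    (GRing.Scale.Law.clone _ _ *:%R _) (fun (r : R) (w : W) => r *: w).
  split=> [w|r] b x1 x2 /=; first by rewrite scalerDl scalerA.
  by rewrite scalerDr !scalerA mulrC.
pose Bmix := bilinear_isBilinear.Build R R W W _ _ _ Bbilin.
pose B : {bilinear R -> W -> W} := HB.pack (fun (r : R) (w : W) => r *: w) Bmix.
have sc : continuous (fun q : R * W => B q.1 q.2) by exact: scale_continuous.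
have dp := differentiable_pair da df.
have dB := @differentiable_bilin R R W W B (a x, f x) sc.
split; first exact: (differentiable_comp dp dB).
move=> v.
have -> : (fun y => a y *: f y) = (fun q => B q.1 q.2) \o (fun y => (a y, f y)).
  by [].
by rewrite diff_comp// diff_bilin// diff_pair.
Qed.

Lemma Ck_sub V W k (A B : set V) (f : V -> W) : A `<=` B -> Ck k B f -> Ck k A f.
Proof.
move=> AB; elim: k f => [|k IH] f /=; first by move=> fB x /AB /fB.
by move=> [df Df]; split=> [x /AB /df //|v]; exact: IH.
Qed.

Lemma CkS V W k (A : set V) (f : V -> W) : Ck k.+1 A f -> Ck k A f.
Proof.
elim: k f => [|k IH] f; first by move=> [df _] x /df /differentiable_continuous.
by move=> [df Df]; split=> // v; apply: IH.
Qed.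

Lemma eq_Ck V W k (A : set V) (f g : V -> W) : open A ->
  (forall x, A x -> f x = g x) -> Ck k A f -> Ck k A g.
Proof.
move=> oA.
have nA (h1 h2 : V -> W) : (forall x, A x -> h1 x = h2 x) ->
    forall x, A x -> {near x, h1 =1 h2}.
  move=> h12 x Ax; rewrite /prop_near1; near=> y; apply: h12; near: y.
  exact: open_nbhs_nbhs.
elim: k f g => [|k IH] f g fg /=.
  move=> cf x Ax; suff: g y @[y --> x] --> g x by [].
  rewrite -(fg _ Ax); apply: cvg_trans (cf _ Ax).
  by apply: near_eq_cvg; exact: nA.
move=> [df Df]; split=> [x Ax|v].
  exact: near_eq_differentiable (nA _ _ fg _ Ax) (df _ Ax).
by apply: IH (Df v) => x Ax; apply: near_eq_derive; exact: nA.
Unshelve. all: by end_near. Qed.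

Lemma Ck_cst V W k (A : set V) (w : W) : open A -> Ck k A (fun=> w).
Proof.
move=> oA; elim: k w => [|k IH] w /=; first by move=> x _; exact: cst_continuous.
split=> [x _|v]; first exact: differentiable_cst.
by apply: eq_Ck (IH 0) => // x _; rewrite derive_cst.
Qed.

Lemma CkD V W k (A : set V) (f g : V -> W) : open A ->
  Ck k A f -> Ck k A g -> Ck k A (fun x => f x + g x).
Proof.
move=> oA; elim: k f g => [|k IH] f g /=.
  by move=> cf cg x Ax; apply: continuousD; [exact: cf|exact: cg].
move=> [df Df] [dg Dg]; split=> [x Ax|v].
  by apply: differentiableD; [exact: df|exact: dg].
apply: eq_Ck (IH _ _ (Df v) (Dg v)) => // x Ax.
by rewrite -deriveD//; apply: diff_derivable; [exact: df|exact: dg].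
Qed.

Lemma Ck_sum V W k n (A : set V) (f : 'I_n -> V -> W) : open A ->
  (forall i, Ck k A (f i)) -> Ck k A (fun x => \sum_i f i x).
Proof.
move=> oA; elim: n f => [|n IH] f Cf.
  by apply: eq_Ck (Ck_cst k 0 oA) => // x _; rewrite big_ord0.
apply: eq_Ck (CkD oA (Cf ord0) (IH (fun i => f (lift ord0 i)) (fun i => Cf _))).
  by [].
by move=> x _; rewrite big_ord_recl.
Qed.

Lemma CkZ V W k (A : set V) (a : V -> R) (f : V -> W) : open A ->
  Ck k A a -> Ck k A f -> Ck k A (fun x => a x *: f x).
Proof.
move=> oA; elim: k a f => [|k IH] a f.
  by move=> ca cf x Ax; apply: cvgZ; [exact: ca|exact: cf].
move=> Ca Cf; have [da Da] := Ca; have [df Df] := Cf.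
split=> [x Ax|v].
  by case: (differentiable_scale (da _ Ax) (df _ Ax)).
apply: eq_Ck (CkD oA (IH _ _ (CkS Ca) (Df v)) (IH _ _ (Da v) (CkS Cf))) => //.
move=> x Ax; have [dZ ZE] := differentiable_scale (da _ Ax) (df _ Ax).
rewrite !deriveE ?ZE//; [exact: da|exact: df].
Qed.

Lemma Ck_coord V m n k (A : set V) (f : V -> 'M[R]_(m, n)) i j : open A ->
  Ck k A f -> Ck k A (fun x => f x i j).
Proof.
move=> oA; elim: k f => [|k IH] f /=.
  move=> cf x Ax; apply: (@continuous_comp _ _ _ f (fun M => M i j)).
    exact: cf.
  exact: coord_continuous.
move=> [df Df]; split=> [x Ax|v].
  apply: (@differentiable_comp _ _ _ _ f (fun M => M i j)); first exact: df.
  exact: differentiable_coord.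
apply: eq_Ck (IH _ (Df v)) => // x Ax.
by rewrite derive_mx ?mxE//; apply/diff_derivable/df.
Qed.

Lemma diff_comp_sum V W n (f : 'rV[R]_n -> W) (g : V -> 'rV[R]_n) x v :
  differentiable g x -> differentiable f (g x) ->
  'D_v (f \o g) x =
  \sum_i ('D_v g x) 0 i *: ('D_(delta_mx 0 i) f) (g x).
Proof.
move=> dg df; rewrite !deriveE//; last exact: differentiable_comp.
rewrite diff_comp//= [in LHS](row_sum_delta ('d g x v)) linear_sum.
by apply: eq_bigr => i _; rewrite linearZ deriveE.
Qed.

(** By the chain rule the derivative of the composite is a sum of products of coordinates of
    ['D_v g] with partial derivatives of [f] composed with [g]; induction applies to these. The
    middle space has coordinates, which makes the sum finite. *)
Lemma Ck_comp V W n k (A : set V) (B : set 'rV[R]_n) (f : 'rV[R]_n -> W)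
    (g : V -> 'rV[R]_n) : open A -> open B -> (forall x, A x -> B (g x)) ->
  Ck k B f -> Ck k A g -> Ck k A (f \o g).
Proof.
move=> oA oB AB; elim: k f g AB => [|k IH] f g AB.
  by move=> cf cg x Ax; apply: continuous_comp; [exact: cg|apply: cf; exact: AB].
move=> [df Df] Cg; have [dg Dg] := Cg; split=> [x Ax|v].
  by apply: differentiable_comp; [exact: dg|apply: df; exact: AB].
apply: (@eq_Ck _ _ _ _
  (fun x => \sum_i ('D_v g x) 0 i *: (('D_(delta_mx 0 i) f) \o g) x)) => //.
  by move=> x Ax; rewrite diff_comp_sum /=; [|exact: dg|apply: df; exact: AB].
apply: Ck_sum => // i; apply: CkZ => //; first by apply: (Ck_coord 0 i oA (Dg v)).
by apply: IH => //; [exact: Df|exact: (CkS Cg)].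
Qed.

Lemma derive_shift_arg W (f : R -> W) (r v t : R) :
  'D_v (fun u => f (u + r)) t = 'D_v f (t + r).
Proof.
rewrite /derive; set F := fun h : R => _; set G := fun h : R => _.
by suff -> : F = G by []; apply/funext => h; rewrite /F /G /= addrA.
Qed.

Lemma Ck_shift W k (A : set R) (f : R -> W) (r : R) : Ck k A f ->
  Ck k [set t | A (t + r)] (fun t => f (t + r)).
Proof.
elim: k f => [|k IH] f /=.
  move=> cf t At; apply: (@continuous_comp _ _ _ (fun u => u + r) f).
    by apply: continuousD; [exact: cvg_id|exact: cvg_cst].
  exact: cf.
move=> [df Df]; split=> [t At|v].
  apply: (@differentiable_comp _ _ _ _ (fun u => u + r) f).
    exact: differentiableD.
  exact: df.
have -> : 'D_v (fun u => f (u + r)) = (fun t => 'D_v f (t + r)).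
  by apply/funext => t; rewrite derive_shift_arg.
exact: (IH _ (Df v)).
Qed.

End smooth_calculus.

(** * Changes of charts *)

Section charts.
Variables (R : realType) (n : nat) (M : smooth_manifold R n).
Implicit Types (c d : chart R M n) (x : M).

Lemma open_chart_image c (O : set M) : open O -> open (cmap c @` (dom c `&` O)).
Proof.
move=> oO; rewrite openE => _ [x [cx Ox] <-].
have iz : (cmap c @` dom c) (cmap c x) by exists x.
have nO : nbhs (cinv c (cmap c x)) O.
  by rewrite cmapK//; exact: open_nbhs_nbhs.
have n1 : \forall z \near cmap c x, O (cinv c z) by exact: (cinv_cont iz nO).
have n2 : \forall z \near cmap c x, (cmap c @` dom c) z.
  by apply: open_nbhs_nbhs; split=> //; exact: image_open.
near=> z; have [y cy yz] : (cmap c @` dom c) z by near: z.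
exists y => //; split=> //; rewrite -(cmapK cy) yz.
by near: z.
Unshelve. all: by end_near. Qed.

Lemma transition_smooth c d : atlas c -> atlas d ->
  smooth_on (cmap c @` (dom c `&` dom d)) (transition c d).
Proof. by move=> ac ad; have [] := atlas_compatible ac ad. Qed.

Lemma transition_differentiable c d x : atlas c -> atlas d -> dom c x -> dom d x ->
  differentiable (transition c d) (cmap c x).
Proof.
move=> ac ad cx dx; have [+ _] := transition_smooth ac ad 1%N.
by apply; exists x.
Qed.

(** Continuity of [k] keeps it in the domain of [c] near [t], where its reading in [d] is the
    transition map after its reading in [c]. A general source [V] covers curves, inverse charts (the
    cocycle rule for Jacobians) and parametrized leaves. *)
Lemma change_chart (V : normedModType R) (k : V -> M) t c d :
  atlas c -> atlas d -> {for t, continuous k} -> dom c (k t) -> dom d (k t) ->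
  differentiable (cmap c \o k) t ->
  differentiable (cmap d \o k) t /\
  forall v, 'D_v (cmap d \o k) t = 'D_v (cmap c \o k) t *m chart_jac c d (k t).
Proof.
move=> ac ad kt ckt dkt dck.
have nE : {near t, transition c d \o (cmap c \o k) =1 cmap d \o k}.
  have nc : \forall s \near t, dom c (k s).
    by apply: kt; apply: open_nbhs_nbhs; split=> //; exact: dom_open.
  by apply: filterS nc => s cks; rewrite /transition /= cmapK.
have dT := transition_differentiable ac ad ckt dkt.
have dcomp : differentiable (transition c d \o (cmap c \o k)) t.
  by apply: differentiable_comp.
split=> [|v]; first exact: near_eq_differentiable dcomp.
rewrite -(near_eq_derive _ nE) deriveE// diff_comp//=.
by rewrite /chart_jac -deriveEjacobian// !deriveE.
Qed.

Lemma Ck_change_chart (V : normedModType R) j (A : set V) (k : V -> M) c d :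
  atlas c -> atlas d -> open A -> (forall t, A t -> {for t, continuous k}) ->
  (forall t, A t -> dom c (k t)) -> Ck j A (cmap c \o k) ->
  Ck j (A `&` k @^-1` dom d) (cmap d \o k).
Proof.
move=> ac ad oA kA cA Ck_c.
have oAd : open (A `&` k @^-1` dom d).
  rewrite openE => t [At dt]; apply: filterI; first exact: open_nbhs_nbhs.
  by apply: (kA _ At); apply: open_nbhs_nbhs; split=> //; exact: dom_open.
apply: (@eq_Ck _ _ _ _ _ (transition c d \o (cmap c \o k))) => //.
  by move=> t [At dt]; rewrite /transition /= cmapK//; exact: cA.
apply: (@Ck_comp _ _ _ _ _ _ (cmap c @` (dom c `&` dom d))) => //.
- exact/open_chart_image/dom_open.
- by move=> t [At dt]; exists (k t) => //; split=> //; exact: cA.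
- exact: transition_smooth.
- by apply: Ck_sub Ck_c => t [].
Qed.

Lemma cinv_continuous c x : dom c x -> {for cmap c x, continuous (cinv c)}.
Proof. by move=> cx; apply: cinv_cont; exists x. Qed.

Lemma chart_jac_comp c d d' x (v : 'rV[R]_n) : atlas c -> atlas d -> atlas d' ->
  dom c x -> dom d x -> dom d' x ->
  v *m chart_jac c d' x = v *m chart_jac c d x *m chart_jac d d' x.
Proof.
move=> ac ad ad' cx dx d'x.
have dT := transition_differentiable ac ad cx dx.
have := @change_chart _ (cinv c) (cmap c x) d d' ad ad' (cinv_continuous cx).
rewrite (cmapK cx) => /(_ dx d'x dT) [dT' /(_ v)].
by rewrite !deriveEjacobian.
Qed.

Lemma chart_jac_id c x (v : 'rV[R]_n) : atlas c -> dom c x -> v *m chart_jac c c x = v.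
Proof.
move=> ac cx; rewrite /chart_jac -deriveEjacobian; last first.
  exact: transition_differentiable.
rewrite -[RHS](derive_id (cmap c x) v); apply: near_eq_derive.
have : \forall z \near cmap c x, (cmap c @` dom c) z.
  by apply: open_nbhs_nbhs; split; [exact: image_open|exists x].
by apply: filterS => _ [y cy <-]; rewrite /transition /= cmapK.
Qed.

End charts.

(** * Differentials of smooth maps read in charts *)

Section immersed.
Variables (R : realType) (m n : nat) (N : smooth_manifold R m).
Variables (M : smooth_manifold R n) (f : N -> M).
Hypothesis fsm : smooth_map f.

Lemma smooth_map_differentiable (e : chart R N m) (c : chart R M n) a :
  atlas e -> atlas c -> dom e a -> dom c (f a) ->
  differentiable (cmap c \o f \o cinv e) (cmap e a).
Proof.
move=> ae ac ea cfa; have [_ /(_ _ _ ae ac 1%N) [+ _]] := fsm.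
by apply; exists a.
Qed.

Lemma smooth_map_continuous (e : chart R N m) a : dom e a ->
  {for cmap e a, continuous (f \o cinv e)}.
Proof.
move=> ea; apply: continuous_comp; first exact: cinv_continuous.
by have [cf _] := fsm; exact: cf.
Qed.

Lemma map_jac_derive (e : chart R N m) (c : chart R M n) a (w : 'rV[R]_m) :
  atlas e -> atlas c -> dom e a -> dom c (f a) ->
  w *m map_jac f e c a = 'D_w (cmap c \o (f \o cinv e)) (cmap e a).
Proof.
move=> ae ac ea cfa; rewrite [RHS]deriveEjacobian//.
exact: smooth_map_differentiable.
Qed.

Lemma map_jac_change (e : chart R N m) (c d : chart R M n) a (w : 'rV[R]_m) :
  atlas e -> atlas c -> atlas d -> dom e a -> dom c (f a) -> dom d (f a) ->
  w *m map_jac f e d a = w *m map_jac f e c a *m chart_jac c d (f a).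
Proof.
move=> ae ac ad ea cfa dfa; apply: etrans (map_jac_derive w ae ad ea dfa) _.
apply: etrans _ (congr1 (mulmx^~ _) (esym (map_jac_derive w ae ac ea cfa))).
have := @change_chart _ _ _ _ (f \o cinv e) (cmap e a) c d ac ad
  (smooth_map_continuous ea).
rewrite /= (cmapK ea) => /(_ cfa dfa) [|_ -> //].
exact: smooth_map_differentiable.
Qed.

End immersed.

(** * Flat charts *)

(* A nondegenerate interval has positive measure, so a continuous function with
   countably many values on an interval is constant by the IVT. *)
Lemma countable_range_const (R : realType) (phi : R -> R) (C : set R) (a b : R) :
  a <= b -> {within `[a, b], continuous phi} -> countable C ->
  (forall s, s \in `[a, b] -> C (phi s)) -> phi a = phi b.
Proof.
move=> ab cphi cC Cphi; apply/eqP/negPn/negP => neq.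
pose m := Num.min (phi a) (phi b); pose M := Num.max (phi a) (phi b).
have mM : m < M.
  by rewrite /m /M; have [//|//|h] := ltgtP (phi a) (phi b); rewrite h eqxx in neq.
have sub : `[m, M] `<=` C.
  move=> y /=; rewrite in_itv /= => yI.
  by have [s sI <-] := IVT ab cphi yI; exact: Cphi.
have : lebesgue_measure (`[m, M] : set R) = 0.
  by apply: countable_lebesgue_measure0; apply: sub_countable cC; exact: subset_card_le.
rewrite lebesgue_measure_itv /= lte_fin mM -EFinB => -[].
by apply/eqP; rewrite subr_eq0 gt_eqF.
Qed.

Lemma segment_ball (R : realType) (V : normedModType R) (x y : V) r s :
  ball x r y -> s \in `[0, 1] -> ball x r (x + s *: (y - x)).
Proof.
rewrite in_itv /= -ball_normE /= => xy /andP[s0 s1].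
rewrite opprD addrA subrr sub0r normrN normrZ ger0_norm// distrC.
by apply: le_lt_trans xy; rewrite ler_piMl.
Qed.

Lemma line_continuous (R : realType) (V : normedModType R) (x h : V) :
  continuous (fun s : R => x + s *: h).
Proof.
move=> s; apply: cvgD; first exact: cvg_cst.
by apply: cvgZ; [exact: cvg_id|exact: cvg_cst].
Qed.

Section flat.
Variables (R : realType) (p q : nat) (M : smooth_manifold R (p + q)).
Variable F : foliation M.
Implicit Types (c d : chart R M (p + q)) (x y : M).

Lemma param_plaque (N : smooth_manifold R p) (f : N -> M) x c a :
  immersed_param f [set y | leaf F x y] -> flat_chart (leaf F) c ->
  dom c (f a) ->
  \forall b \near a, dom c (f b) /\
     rsubmx (cmap c (f b)) = rsubmx (cmap c (f a)).
Proof.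
move=> [_ [[cf _] _] _ fL] [_ _ plaq] cfa.
have Lf b : leaf F x (f b) by have : range f (f b) by []; rewrite fL.
have [e ae ea] := atlas_cover a.
have [C cC CP] := plaq x.
pose U := cmap e @` (dom e `&` f @^-1` dom c).
have oU : open U.
  apply: open_chart_image; move/continuousP: cf; apply; exact: dom_open.
have /nbhs_ballP[r r0 rU] : nbhs (cmap e a) U.
  by apply: open_nbhs_nbhs; split=> //; exists a.
have nB : \forall b \near a, ball (cmap e a) r (cmap e b).
  by apply: (cmap_cont ea); exact: nbhsx_ballx.
have nD : \forall b \near a, dom e b.
  by apply: open_nbhs_nbhs; split=> //; exact: dom_open.
have nC : \forall b \near a, dom c (f b).
  by apply: cf; apply: open_nbhs_nbhs; split=> //; exact: dom_open.
near=> b.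
have cb : dom c (f b) by near: b.
have eb : dom e b by near: b.
have Bb : ball (cmap e a) r (cmap e b) by near: b.
split=> //; apply/rowP => j; rewrite !mxE.
pose l s := cmap e a + s *: (cmap e b - cmap e a).
pose phi s := cmap c (f (cinv e (l s))) 0 (rshift p j).
have lU s : s \in `[0, 1] -> U (l s) by move=> sI; apply/rU/segment_ball.
have -> : cmap c (f a) 0 (rshift p j) = phi 0.
  by rewrite /phi /l scale0r addr0 (cmapK ea).
have -> : cmap c (f b) 0 (rshift p j) = phi 1.
  by rewrite /phi /l scale1r addrC subrK (cmapK eb).
(* [C] lists the plaques of the leaf in this chart; its projection to the coordinate [j] is still
   countable. *)
apply/esym/(@countable_range_const _ phi ((fun z : 'rV[R]_q => z 0 j) @` C)) => //.
- apply: continuous_in_subspaceT => s; rewrite inE => /lU [a' [ea' ca'] a'E].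
  apply: (@continuous_comp _ _ _ (fun s => cinv e (l s))
    (fun b' => cmap c (f b') 0 (rshift p j))).
    apply: (@continuous_comp _ _ _ l (cinv e)); first exact: line_continuous.
    by rewrite -a'E; exact: cinv_continuous.
  rewrite -a'E (cmapK ea').
  apply: (@continuous_comp _ _ _ (fun b' => cmap c (f b')) (fun z => z 0 (rshift p j))).
    by apply: continuous_comp; [exact: cf|exact: cmap_cont].
  exact: coord_continuous.
- exact: sub_countable (card_image_le _ _) cC.
- move=> s /lU [a' [ea' ca'] a'E].
  exists (rsubmx (cmap c (f a'))); first exact/CP.
  by rewrite /phi -a'E (cmapK ea') mxE.
Unshelve. all: by end_near. Qed.

(** The transverse coordinates of [f] are constant near [a], so their derivatives vanish. *)
Lemma map_jac_flat (N : smooth_manifold R p) (f : N -> M) x c e a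
    (w : 'rV[R]_p) :
  immersed_param f [set y | leaf F x y] -> flat_chart (leaf F) c ->
  atlas e -> dom e a -> dom c (f a) -> rsubmx (w *m map_jac f e c a) = 0.
Proof.
move=> fP fc ae ea cfa; have ac : atlas c by case: fc.
have [_ [fsm _] _ _] := fP.
apply: etrans (congr1 rsubmx (map_jac_derive fsm w ae ac ea cfa)) _.
have dh := smooth_map_differentiable fsm ae ac ea cfa.
apply/rowP => j; rewrite !mxE derive_mx; last exact: diff_derivable.
rewrite mxE.
rewrite -(derive_cst (cmap c (f a) 0 (rshift p j)) (cmap e a) w).
apply: near_eq_derive.
have nb := param_plaque fP fc cfa.
have ce : cinv e z @[z --> cmap e a] --> a.
  by rewrite -[X in _ --> X](cmapK ea); exact: cinv_continuous.
have nz : \forall z \near cmap e a, dom c (f (cinv e z)) /\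
    rsubmx (cmap c (f (cinv e z))) = rsubmx (cmap c (f a)) by exact: (ce _ nb).
near=> z; have : dom c (f (cinv e z)) /\
    rsubmx (cmap c (f (cinv e z))) = rsubmx (cmap c (f a)) by near: z.
by move=> [_ /rowP /(_ j)]; rewrite !mxE.
Unshelve. all: by end_near. Qed.

(** One direction is the vanishing of transverse derivatives along the leaf. The other is a
    dimension count: an injective differential with zero transverse block fills the whole
    [p]-dimensional vertical space. *)
Lemma flat_vertical c x v : flat_chart (leaf F) c -> dom c x ->
  vertical F c x v <-> rsubmx v = 0.
Proof.
move=> fc cx; have ac : atlas c by case: fc.
split=> [[N [f [e [a [w [fP ae ea fa ->]]]]]]|v0].
  by apply: map_jac_flat => //; rewrite ?fa//; exact: fP.
have [N [f fP]] := leaf_immersed F x.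
have [a fa] : exists a, f a = x.
  have [_ _ _ fL] := fP.
  have : range f x by rewrite fL /=.
  by move=> [a _ fa]; exists a.
have [e ae ea] := atlas_cover a.
have cfa : dom c (f a) by rewrite fa.
have [_ [_ /(_ e c a ae ac ea cfa) Jfree] _ _] := fP.
set J := map_jac f e c a in Jfree.
have J0 : J = row_mx (lsubmx J) 0.
  rewrite -[LHS]hsubmxK; congr row_mx; apply/row_matrixP => i.
  rewrite row0 rowE mulmx_rsub; exact: map_jac_flat fP fc ae ea cfa.
(* The zero block adds no rank, so the square left block inherits the full rank [p]; its inverse
   gives the leaf vector that maps to [v]. *)
have Ju : lsubmx J \in unitmx.
  have rJ : \rank J = \rank (lsubmx J) by rewrite {1}J0 rank_row_mx0.
  by rewrite -row_free_unit /row_free -rJ.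
exists N, f, e, a, (lsubmx v *m invmx (lsubmx J)); split=> //.
by rewrite -/J {2}J0 mul_mx_row mulmx0 mulmxKV// -[LHS]hsubmxK v0.
Qed.

Lemma vertical_change c d x v : atlas c -> atlas d -> dom c x -> dom d x ->
  vertical F c x v -> vertical F d x (v *m chart_jac c d x).
Proof.
move=> ac ad cx dx [N [f [e [a [w [fP ae ea fa ->]]]]]].
exists N, f, e, a, w; split=> //; rewrite -fa in cx dx *.
have [_ [fsm _] _ _] := fP.
exact: esym (map_jac_change fsm w ae ac ad ea cx dx).
Qed.

End flat.

(** * Metrics and wedges along plaques *)

(** The points where [f] takes the value [f x] form a subset of [A] that is relatively open and
    relatively closed. [Y] needs no topology: below the values are sets of vectors, then
    propositions. *)
Lemma connected_locally_constant (T : topologicalType) (Y : Type) (A : set T)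
    (f : T -> Y) : connected A ->
  (forall x, A x -> \forall y \near x, A y -> f y = f x) ->
  forall x y, A x -> A y -> f y = f x.
Proof.
move=> cA lf x y Ax Ay.
pose B := A `&` [set z | f z = f x].
suff BA : B = A by move: Ay; rewrite -BA => -[].
apply: cA; first by exists x.
- exists [set z | A z -> f z = f x]^°; first exact: open_interior.
  apply/seteqP; split=> z [Az]; last by move/interior_subset/(_ Az).
  by move=> fz; split=> //; apply: filterS (lf _ Az) => w + Aw => ->.
- exists (~` [set z | A z -> f z <> f x]^°).
    by rewrite closedC; exact: open_interior.
  apply/seteqP; split=> z [Az].
    by move=> fz; split=> // /interior_subset/(_ Az).
  move=> nz; split=> //; apply: contrapT => fz; apply: nz.
  by apply: filterS (lf _ Az) => w + Aw => ->.
Qed.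

Lemma connected_in_component (T : topologicalType) (A B : set T) u v w :
  connected B -> B `<=` A -> B u -> B v ->
  connected_component A w u -> connected_component A w v.
Proof.
move=> cB BA Bu Bv wu; apply: connected_component_trans wu _.
exact: (connected_component_max Bu BA cB).
Qed.

Lemma connected_segment (R : realType) (V : normedModType R) (x h : V) :
  connected [set x + s *: h | s in `[0 : R, 1]].
Proof.
apply: connected_continuous_connected; first exact: segment_connected.
apply: continuous_subspaceT; exact: line_continuous.
Qed.

Lemma line_is_diff (R : realType) (V : normedModType R) (x h : V) (s : R) :
  is_diff s (fun r => x + r *: h) ( *:%R ^~ h).
Proof.
have := is_diffD (is_diff_cst x s) (is_diff_scalel s h).
by rewrite add0r.
Qed.

Section plaques.
Variables (R : realType) (p q : nat) (M : smooth_manifold R (p + q)).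
Variable F : foliation M.
Implicit Types (c d : chart R M (p + q)) (x y : M).

(** The image of a flat chart is a box. *)
Lemma flat_convex c z h s : flat_chart (leaf F) c ->
  (cmap c @` dom c) z -> (cmap c @` dom c) (z + h) -> s \in `[0, 1] ->
  (cmap c @` dom c) (z + s *: h).
Proof.
move=> [_ [a [b ->]] _] /= az azh; rewrite in_itv /= => /andP[s0 s1] i.
have /andP[az1 zb1] := az i; have := azh i; rewrite !mxE => /andP[az2 zb2].
have pos (u v : R) : 0 < u -> 0 < v -> 0 < (1 - s) * u + s * v.
  move=> u0 v0; move: s0; rewrite le_eqVlt => /predU1P[<-|s0'].
    by rewrite subr0 mul1r mul0r addr0.
  by rewrite ltr_wpDl ?mulr_gt0// mulr_ge0// ?subr_ge0// ltW.
have := pos _ _ (etrans (subr_gt0 _ _) az1) (etrans (subr_gt0 _ _) az2).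
have := pos _ _ (etrans (subr_gt0 _ _) zb1) (etrans (subr_gt0 _ _) zb2).
by move=> hb ha; apply/andP; split; lra.
Qed.

Variable g : transverse_metric F.

(** This is the test field for [metric_lie]: constant in the chart [c], and carried to every other
    chart by the Jacobian. *)
Lemma vertical_constant_field c v : flat_chart (leaf F) c -> rsubmx v = 0 ->
  vertical_field F (dom c) (fun d x => v *m chart_jac c d x).
Proof.
move=> fc v0; have ac : atlas c by case: fc.
split.
- move=> d d' x ad ad' cx dx d'x; exact: chart_jac_comp.
- move=> d ad k.
  have oI (c1 c2 : chart R M (p + q)) : open (cmap c1 @` (dom c1 `&` dom c2)).
    exact/open_chart_image/dom_open.
  rewrite [dom c `&` dom d]setIC.
  apply: (@eq_Ck _ _ _ _ _ ('D_v (transition c d) \o transition d c)) => //.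
    move=> _ [x [dx cx] <-]; rewrite /= /transition /= (cmapK dx).
    by rewrite deriveEjacobian//; exact: transition_differentiable.
  apply: (@Ck_comp _ _ _ _ _ _ (cmap c @` (dom c `&` dom d))) => //.
  + by move=> _ [x [dx cx] <-]; exists x; rewrite // /transition /= (cmapK dx).
  (* A directional derivative costs one order of differentiability. *)
  + by have [_] := transition_smooth ac ad k.+1; exact.
  + exact: transition_smooth.
- move=> d x ad cx dx; apply: vertical_change => //.
  exact/(flat_vertical _ fc).
Qed.

(** For a field with constant components the two Jacobian terms of the Lie derivative vanish,
    leaving only the directional derivative of the metric. *)
Lemma metric_derive_vertical c x v : flat_chart (leaf F) c -> dom c x ->
  rsubmx v = 0 -> 'D_v (metric g c \o cinv c) (cmap c x) = 0.
Proof.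
move=> fc cx v0; have ac : atlas c by case: fc.
have := metric_lie g (dom_open c) (vertical_constant_field fc v0) ac cx cx.
rewrite /lie_derivative.
set W := (fun d x => v *m chart_jac c d x) c \o cinv c.
have WE : {near cmap c x, cst v =1 W}.
  have : \forall z \near cmap c x, (cmap c @` dom c) z.
    by apply: open_nbhs_nbhs; split; [exact: image_open|exists x].
  by apply: filterS => _ [y cy <-]; rewrite /W /= (cmapK cy) (chart_jac_id v ac cy).
have dW : differentiable W (cmap c x).
  by apply: near_eq_differentiable WE _; exact: differentiable_cst.
have JW : 'J W (cmap c x) = 0.
  apply/row_matrixP => i; rewrite row0 rowE -deriveEjacobian//.
  by rewrite -(near_eq_derive _ WE) derive_cst.
by rewrite JW trmx0 mulmx0 mul0mx !addr0 (chart_jac_id v ac cx).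
Qed.

(** The segment between the two points is vertical and stays in the box; the mean value theorem,
    applied to each entry along it, sees a zero derivative. *)
Lemma metric_plaque c x y : flat_chart (leaf F) c -> dom c x -> dom c y ->
  rsubmx (cmap c x) = rsubmx (cmap c y) -> metric g c x = metric g c y.
Proof.
move=> fc cx cy xy; have ac : atlas c by case: fc.
pose h := cmap c y - cmap c x.
have h0 : rsubmx h = 0 by rewrite /h linearB /= xy subrr.
pose l (s : R) := cmap c x + s *: h.
have lI (s : R) : s \in `[0, 1] -> (cmap c @` dom c) (l s).
  move=> sI; apply: (flat_convex fc) sI; first by exists x.
  by exists y; rewrite // /h addrC subrK.
pose G := metric g c \o cinv c.
have dG (s : R) : s \in `[0, 1] -> differentiable (G \o l) s /\ 'D_1 (G \o l) s = 0.
  move=> /lI ls; have dGz : differentiable G (l s).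
    by have [dG _] := (metric_tensor g).2 c ac 1%N; exact: dG.
  have [dl lE] := line_is_diff (cmap c x) h s.
  split; first exact: differentiable_comp.
  rewrite deriveE; last exact: differentiable_comp.
  rewrite diff_comp// lE /= scale1r.
  rewrite -deriveE//; have [z cz <-] := ls.
  exact: metric_derive_vertical.
apply/matrixP => i j.
have -> : metric g c x i j = G (l 0) i j by rewrite /G /l /= scale0r addr0 cmapK.
have -> : metric g c y i j = G (l 1) i j.
  by rewrite /G /l /= scale1r /h addrC subrK cmapK.
have [||s _] := @MVT_segment R (fun s => G (l s) i j) (fun=> 0) 0 1 ler01.
- move=> s /subset_itv_oo_cc/dG [dGs Ds].
  have dv : derivable (G \o l) s 1 by exact: diff_derivable.
  apply: DeriveDef; first by move/derivable_mxP : dv; exact.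
  have := derive_mx dv; rewrite Ds => /matrixP /(_ i j).
  by rewrite !mxE.
- apply: continuous_in_subspaceT => s; rewrite inE => /dG [dGs _].
  apply: (@continuous_comp _ _ _ (G \o l) (fun A => A i j)).
    exact: differentiable_continuous.
  exact: coord_continuous.
- by rewrite mul0r => /eqP; rewrite subr_eq0 => /eqP.
Qed.

Lemma tcausal_plaque c x y : flat_chart (leaf F) c -> dom c x -> dom c y ->
  rsubmx (cmap c x) = rsubmx (cmap c y) -> tcausal g c x = tcausal g c y.
Proof.
move=> fc cx cy xy; apply/seteqP; split=> v [/= nv gv]; split.
- by rewrite (flat_vertical _ fc cy) -(flat_vertical _ fc cx).
- by rewrite -(metric_plaque fc cx cy xy).
- by rewrite (flat_vertical _ fc cx) -(flat_vertical _ fc cy).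
- by rewrite (metric_plaque fc cx cy xy).
Qed.

(** A vertical [h] lies in the kernel of the metric, on either side by symmetry, so adding it
    changes neither the quadratic form nor the transverse part of [v]. *)
Lemma tcausal_add_vertical c x v h : flat_chart (leaf F) c -> dom c x ->
  rsubmx h = 0 -> tcausal g c x v -> tcausal g c x (v + h).
Proof.
move=> fc cx h0 [nv gv]; have ac : atlas c by case: fc.
split.
  rewrite (flat_vertical _ fc cx) linearD /= h0 addr0.
  by rewrite -(flat_vertical _ fc cx).
have hker w : bform (metric g c x) h w = 0.
  by move: w; apply/metric_ker => //; apply/(flat_vertical _ fc cx).
have kerh w : bform (metric g c x) w h = 0.
  rewrite -(hker w) /bform -[in LHS](metric_symmetric g ac cx).
  by rewrite -[w in LHS]trmxK -!trmx_mul [in LHS]mxE mulmxA.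
have bD w w1 w2 : bform (metric g c x) w (w1 + w2) =
    bform (metric g c x) w w1 + bform (metric g c x) w w2.
  by rewrite /bform linearD mulmxDr mxE.
rewrite bD kerh addr0.
suff -> : bform (metric g c x) (v + h) v = bform (metric g c x) v v by [].
have := hker v; rewrite /bform => hv; rewrite !mulmxDl mxE hv; exact: addr0.
Qed.

Variable T : time_orientation g.

Lemma wedge_sub c x : atlas c -> dom c x -> wedge T c x `<=` tcausal g c x.
Proof.
move=> ac cx; have [v _ ->] := wedge_component T ac cx.
exact: connected_component_sub.
Qed.

Lemma wedge_join c x (B : set 'rV[R]_(p + q)) u v : atlas c -> dom c x ->
  connected B -> B `<=` tcausal g c x -> B u -> B v ->
  wedge T c x u -> wedge T c x v.
Proof.
move=> ac cx cB BK Bu Bv; have [w _ ->] := wedge_component T ac cx.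
exact: connected_in_component Bu Bv.
Qed.

(** The segment from [v] to [v + h] stays transversely causal, hence in one component. *)
Lemma wedge_add_vertical c x v h : flat_chart (leaf F) c -> dom c x ->
  rsubmx h = 0 -> wedge T c x v -> wedge T c x (v + h).
Proof.
move=> fc cx h0 wv; have ac : atlas c by case: fc.
apply: (wedge_join ac cx (@connected_segment _ _ v h)) (wv).
- move=> _ [s _ <-]; apply: tcausal_add_vertical => //.
    by rewrite linearZ /= h0 scaler0.
  exact: (wedge_sub ac cx).
- by exists 0; rewrite ?scale0r ?addr0// /= in_itv /= lexx ler01.
- by exists 1; rewrite ?scale1r// /= in_itv /= lexx ler01.
Qed.

Lemma wedge_component_of c x u : atlas c -> dom c x -> wedge T c x u ->
  wedge T c x = connected_component (tcausal g c x) u.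
Proof.
move=> ac cx; have [v _ ->] := wedge_component T ac cx.
exact: same_connected_component.
Qed.

(** Along the vertical segment from [x] to [y] the set of causal vectors does not change. The local
    continuous field of future vectors traces a path in this fixed set, so the chosen component is
    locally constant, hence constant on the segment. *)
Lemma wedge_plaque c x y : flat_chart (leaf F) c -> dom c x -> dom c y ->
  rsubmx (cmap c x) = rsubmx (cmap c y) -> wedge T c x = wedge T c y.
Proof.
move=> fc cx cy xy; have ac : atlas c by case: fc.
pose h := cmap c y - cmap c x.
have h0 : rsubmx h = 0 by rewrite /h linearB /= xy subrr.
pose l (s : R) := cmap c x + s *: h.
have lI (s : R) : s \in `[0, 1] -> (cmap c @` dom c) (l s).
  move=> sI; apply: (flat_convex fc) sI; first by exists x.
  by exists y; rewrite // /h addrC subrK.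
pose k (s : R) := cinv c (l s).
have cl (s : R) : s \in `[0, 1] -> {for s, continuous k}.
  move=> /lI ls; apply: continuous_comp; first exact: line_continuous.
  exact: cinv_cont.
have ck (s : R) : s \in `[0, 1] -> dom c (k s).
  by move=> /lI[z cz zE]; rewrite /k -zE cmapK.
have tk (s : R) : s \in `[0, 1] -> tcausal g c (k s) = tcausal g c x.
  move=> sI; apply: tcausal_plaque => //; first exact: ck.
  have [z cz zE] := lI _ sI; rewrite /k -zE (cmapK cz) zE /l.
  by rewrite linearD linearZ /= h0 scaler0 addr0.
have k0 : k 0 = x by rewrite /k /l scale0r addr0 cmapK.
have k1 : k 1 = y by rewrite /k /l scale1r /h addrC subrK cmapK.
rewrite -k0 -k1; apply/esym.
apply: (@connected_locally_constant R _ `[0, 1] (fun s => wedge T c (k s)) _ _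
  0 1).
- exact: segment_connected.
- move=> s sI.
  have [U [X [oU Us Uc UX]]] := wedge_cont T ac (ck _ sI).
  have /nbhs_ballP[r r0 rU] : nbhs s (k @^-1` U).
    by apply: (cl _ sI); exact: open_nbhs_nbhs.
  near=> t => tI; have tB : ball s r t by near: t; exact: nbhsx_ballx.
  (* The parameter segment from [s] to [t] remains in the ball where the field [X] is available and
     in the unit interval. *)
  pose m (u : R) := s + u *: (t - s).
  have mU (u : R) : u \in `[0, 1] -> U (k (m u)) by move=> uI; apply/rU/segment_ball.
  have mI (u : R) : u \in `[0, 1] -> m u \in `[0, 1].
    move: sI tI => /=; rewrite !in_itv /= => /andP[s0 s1] /andP[t0 t1].
    move=> /andP[u0 u1]; rewrite /m /GRing.scale /=.
    by apply/andP; split; nra.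
  have m0 : m 0 = s by rewrite /m scale0r addr0.
  have m1 : m 1 = t by rewrite /m scale1r addrC subrK.
  have st : connected_component (tcausal g c x) (X (k s)) (X (k t)).
    apply: (@connected_component_max _ _ [set X (k (m u)) | u in `[0, 1]]).
    + by exists 0; rewrite ?m0// /= in_itv /= lexx ler01.
    + move=> _ [u uI <-]; rewrite -(tk _ (mI _ uI)).
      by apply: (wedge_sub ac (ck _ (mI _ uI))); have [] := UX _ (mU _ uI).
    + apply: connected_continuous_connected; first exact: segment_connected.
      apply: continuous_in_subspaceT => u; rewrite inE => uI.
      apply: (@continuous_comp _ _ _ (k \o m) X); last first.
        by have [] := UX _ (mU _ uI).
      apply: continuous_comp; first exact: line_continuous.
      exact: cl (mI _ uI).
    + by exists 1; rewrite ?m1// /= in_itv /= lexx ler01.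
  rewrite (wedge_component_of ac (ck _ tI) (proj2 (UX _ _))); last first.
    by rewrite -m1; apply: mU; rewrite in_itv /= lexx ler01.
  rewrite (wedge_component_of ac (ck _ sI) (proj2 (UX _ Us))).
  by rewrite !tk//; exact/esym/same_connected_component.
- by rewrite /= in_itv /= lexx ler01.
- by rewrite /= in_itv /= lexx ler01.
Unshelve. all: by end_near. Qed.

End plaques.

(** * Concatenation of causal curves *)

Lemma Ck_line (R : realType) (V : normedModType R) k (A : set R) (x h : V) :
  open A -> Ck k A (fun s => x + s *: h).
Proof.
move=> oA; case: k => [|k]; first by move=> s _; exact: line_continuous.
split=> [s _|v]; first by have [] := line_is_diff x h s.
apply: eq_Ck (Ck_cst k (v *: h) oA) => // s _.
by have [dl lE] := line_is_diff x h s; rewrite deriveE// lE.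
Qed.

Lemma shift_within_continuous (R : realType) (U : topologicalType)
    (f : R -> U) (a b r : R) : {within `[a, b], continuous f} ->
  {within `[a - r, b - r], continuous (fun u => f (u + r))}.
Proof.
move=> /subspace_continuousP cf; apply/subspace_continuousP => u uI N.
have shI v : v \in `[a - r, b - r] -> v + r \in `[a, b].
  by rewrite !in_itv /= lerBlDr lerBrDr.
move=> /(cf _ (shI _ uI)) nN.
have cr : {for u, continuous (fun u : R => u + r)}.
  by apply: continuousD; [exact: cvg_id|exact: cvg_cst].
have nu : \forall v \near u, v + r \in `[a, b] -> N (f (v + r)) by exact: (cr _ nN).
by apply: filterS nu => v vN /shI.
Qed.

Section arcs.
Variables (R : realType) (p q : nat) (M : smooth_manifold R (p + q)).
Variables (F : foliation M) (g : transverse_metric F) (T : time_orientation g).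
Implicit Types (c d : chart R M (p + q)) (x y z : M) (gam : R -> M).

Lemma future_causal_arc_continuous gam s t :
  future_causal_arc T gam s t -> {within `[s, t], continuous gam}.
Proof.
move=> [U [del [oU sU [cdel _] gE _]]].
apply: (@subspace_eq_continuous _ _ _ del).
  by move=> u; rewrite inE => uI; exact: esym (gE u uI).
by apply: continuous_in_subspaceT => u; rewrite inE => /sU/cdel.
Qed.

Lemma eq_future_causal_arc gam gam' s t : {in `[s, t], gam =1 gam'} ->
  future_causal_arc T gam s t -> future_causal_arc T gam' s t.
Proof.
move=> gE [U [del [oU sU sc dE w]]]; exists U, del; split=> //.
by move=> u uI; rewrite -gE// dE.
Qed.

Lemma sub_future_causal_arc gam s t s' t' : `[s', t'] `<=` `[s, t] ->
  future_causal_arc T gam s t -> future_causal_arc T gam s' t'.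
Proof.
move=> sub [U [del [oU sU sc dE w]]]; exists U, del; split=> //.
- exact: subset_trans sU.
- by move=> u /sub /dE.
- by move=> u c /sub uI; exact: w.
Qed.

Lemma shift_future_causal_arc gam s t r : future_causal_arc T gam s t ->
  future_causal_arc T (fun u => gam (u + r)) (s - r) (t - r).
Proof.
move=> [U [del [oU sU [cdel sdel] gE w]]].
have shI u : u \in `[s - r, t - r] -> u + r \in `[s, t].
  by rewrite !in_itv /= lerBlDr lerBrDr.
have cr : continuous (fun u : R => u + r).
  by move=> u; apply: continuousD; [exact: cvg_id|exact: cvg_cst].
exists [set u | U (u + r)], (fun u => del (u + r)); split.
- by have /continuousP := cr; exact.
- by move=> u /shI/sU.
- split=> [u Uu|c ac k].
    by apply: (@continuous_comp _ _ _ (fun u => u + r)); [exact: cr|exact: cdel].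
  exact: Ck_shift (sdel c ac k).
- by move=> u /shI/gE.
- move=> u c uI ac cu; have := w _ c (shI _ uI) ac cu.
  by rewrite -derive_shift_arg.
Qed.

Definition causal_arc x y := exists gam s t,
  [/\ s < t, future_causal_arc T gam s t, gam s = x & gam t = y].

(** Causal curves with parameters forgotten: only the endpoints of the smooth pieces remain, so
    joining and modifying curves become inductions without reparametrization. *)
Inductive causal_chain : M -> M -> Prop :=
| chain_arc x y : causal_arc x y -> causal_chain x y
| chain_cons x y z : causal_arc x y -> causal_chain y z -> causal_chain x z.

Lemma causal_chain_trans x y z :
  causal_chain x y -> causal_chain y z -> causal_chain x z.
Proof.
move=> xy; elim: xy z => {x y} [x y a z|x y z a _ IH w /IH]; exact: chain_cons.
Qed.

Lemma chain_of_curve gam a b :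
  future_causal_curve T gam a b -> causal_chain (gam a) (gam b).
Proof.
move=> [ab _ [s [ps sb arcs]]]; elim: s a b ab ps sb arcs => [|t s IH] a b ab.
  by move=> _ /= eab; rewrite eab ltxx in ab.
move=> /= /andP[at_ ps] sb arcs.
have arc0 : causal_arc (gam a) (gam t).
  by exists gam, a, t; split=> //; exact: (arcs 0%N).
(* With a single breakpoint nothing is left after the first arc; otherwise the rest is a curve on a
   nondegenerate interval. *)
case: s => [|u s] in IH ps sb arcs *.
  by rewrite -sb /=; exact: chain_arc.
have tb : t < b.
  move: ps; rewrite (path_sortedE lt_trans) => /andP[/allP ts _].
  by apply: ts; rewrite -sb /= mem_last.
apply: chain_cons arc0 _; apply: IH => // i si.
have := arcs i.+1 si => /=.
by rewrite !(set_nth_default t a)// ltnW.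
Qed.

Lemma curve_of_chain x y : causal_chain x y ->
  exists gam a b, [/\ future_causal_curve T gam a b, gam a = x & gam b = y].
Proof.
elim=> {x y} [x y [gam [s [t [st arc gs gt]]]]|x y z].
  exists gam, s, t; split=> //; split=> //; first exact: future_causal_arc_continuous.
  by exists [:: t]; split; rewrite //= ?st// => -[|].
move=> [gam [s [t [st arc gs gt]]]] _ [gam' [a [b [[ab cgam' [r [pr rb arcs]]] ga gb]]]].
(* The second curve is shifted in time by [k] so that it starts at [t], where the first arc ends. *)
pose k := a - t.
have ak : a - k = t by rewrite /k; lra.
pose G u := if u <= t then gam u else gam' (u + k).
have G1 : {in `[s, t], gam =1 G}.
  by move=> u; rewrite in_itv /= /G => /andP[_ ->].
have G2 u : t <= u -> gam' (u + k) = G u.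
  rewrite /G le_eqVlt => /predU1P[<-|tu]; last by rewrite leNgt tu.
  by rewrite lexx gt -ga /k addrC subrK.
have tb : t < b - k by rewrite /k; lra.
exists G, s, (b - k); split; last 2 first.
- by rewrite -G1// in_itv /= lexx ltW.
- by rewrite -G2 ?subrK// ltW.
split; first exact: lt_trans tb.
  (* Continuity is checked separately on two closed intervals that cover the whole. *)
  have -> : `[s, b - k]%classic = `[s, t]%classic `|` `[t, b - k]%classic.
    apply/seteqP; split=> u /=; rewrite !in_itv /=.
      move=> /andP[su ub]; have [ut|tu] := leP u t; first by left; rewrite su.
      by right; rewrite ltW.
    move=> [/andP[su ut]|/andP[tu ub]].
      by rewrite su (le_trans ut)// ltW.
    by rewrite ub (le_trans _ tu)// ltW.
  apply: withinU_continuous; [exact: interval_closed|exact: interval_closed| |].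
    apply: (@subspace_eq_continuous _ _ _ gam).
      by move=> u; rewrite inE => /G1.
    exact: future_causal_arc_continuous.
  apply: (@subspace_eq_continuous _ _ _ (fun u => gam' (u + k))).
    by move=> u; rewrite inE /= in_itv /= => /andP[/G2].
  by rewrite -ak; exact: shift_within_continuous.
exists (t :: map (fun u => u - k) r); split.
- rewrite /= st -{1}ak (@path_map _ _ (fun u => u - k)); apply: sub_path pr => u v /=.
  by rewrite ltrD2r.
- by rewrite /= -{1}ak (last_map (fun u => u - k)) rb.
- move=> [_|i] /=; first exact: eq_future_causal_arc G1 arc.
  rewrite ltnS size_map => ir.
  have -> : nth s (t :: [seq u - k | u <- r]) i = nth a (a :: r) i - k.
    by rewrite -{1}ak -(nth_map a s (fun u => u - k)) //= ltnW.
  rewrite (nth_map a)//.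
  apply: eq_future_causal_arc (shift_future_causal_arc k (arcs i ir)).
  move=> u; rewrite in_itv /= => /andP[iu _]; apply: G2; apply: le_trans iu.
  rewrite -{1}ak lerD2r; case: i ir => [_|i ir] //=.
  have /all_nthP := order_path_min lt_trans pr.
  by move=> /(_ a i (ltnW ir)) /ltW.
Qed.

End arcs.

(** * Sliding causal curves along leaves *)

Section slide.
Variables (R : realType) (p q : nat) (M : smooth_manifold R (p + q)).
Variables (F : foliation M) (g : transverse_metric F) (T : time_orientation g).
Implicit Types (c d : chart R M (p + q)) (x y z : M) (gam : R -> M).

(** The ramp moves each point inside its plaque, which preserves the wedge, and adds the vertical
    vector [h] to the velocity, which keeps it in the wedge. *)
Lemma add_vertical_ramp (U : set R) (del : R -> M) c (z h : 'rV[R]_(p + q)) :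
  flat_chart (leaf F) c -> rsubmx z = 0 -> rsubmx h = 0 ->
  open U -> smooth_curve U del ->
  (forall u, U u -> dom c (del u)) ->
  (forall u, U u -> (cmap c @` dom c) (cmap c (del u) + (z + u *: h))) ->
  let del' u := cinv c (cmap c (del u) + (z + u *: h)) in
  smooth_curve U del' /\
  forall u, U u ->
    (forall d, atlas d -> dom d (del u) ->
        wedge T d (del u) ('D_1 (cmap d \o del) u)) ->
    forall d, atlas d -> dom d (del' u) ->
      wedge T d (del' u) ('D_1 (cmap d \o del') u).
Proof.
move=> fc z0 h0 oU [cdel sdel] cU iU del'; have ac : atlas c by case: fc.
pose k u := cmap c (del u) + (z + u *: h).
have sc : smooth_on U (cmap c \o del).
  by move=> j; apply: Ck_sub (sdel c ac j) => u Uu; split=> //; exact: cU.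
have sk : smooth_on U k by move=> j; apply: CkD => //; exact: Ck_line.
have ck u : U u -> {for u, continuous k} by move=> Uu; exact: (sk 0%N).
have c'U u : U u -> dom c (del' u).
  by move=> /iU[y cy yE]; rewrite /del' -yE cmapK.
have kE u : U u -> cmap c (del' u) = k u.
  by move=> /iU[y cy yE]; rewrite /del' /k -yE cmapK.
have c'del u : U u -> {for u, continuous del'}.
  move=> Uu; apply: (@continuous_comp _ _ _ k (cinv c)); first exact: ck.
  by apply: cinv_cont; exact: iU.
have sc' : smooth_on U (cmap c \o del').
  by move=> j; apply: eq_Ck (sk j) => // u Uu; rewrite /= kE.
split.
  split=> [u Uu|d ad j]; first exact: c'del.
  exact: Ck_change_chart (sc' j).
move=> u Uu w d ad du.
have dc : differentiable (cmap c \o del) u by have [+ _] := sc 1%N; exact.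
have dc' : differentiable (cmap c \o del') u by have [+ _] := sc' 1%N; exact.
(* The claim in an arbitrary chart [d] is pulled back to the flat chart [c], where the velocity can
   be computed. *)
have [_ ->] := change_chart ac ad (c'del _ Uu) (c'U _ Uu) du dc'.
rewrite (wedge_chart T ac ad (c'U _ Uu) du).
exists ('D_1 (cmap c \o del') u) => //.
have [dl lE] := line_is_diff z h u.
have -> : 'D_1 (cmap c \o del') u = 'D_1 (cmap c \o del) u + h.
  have -> : 'D_1 (cmap c \o del') u = 'D_1 k u.
    apply: near_eq_derive; near=> v; rewrite /= kE//; near: v.
    exact: open_nbhs_nbhs.
  rewrite deriveD; [|exact: diff_derivable|exact: diff_derivable].
  by congr (_ + _); rewrite deriveE// lE scale1r.
rewrite -(@wedge_plaque _ _ _ _ _ _ T c (del u))//.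
- by apply: wedge_add_vertical => //; [exact: cU|apply: w => //; exact: cU].
- exact: cU.
- exact: c'U.
- by rewrite kE// /k !linearD linearZ /= z0 h0 scaler0 !addr0.
Unshelve. all: by end_near. Qed.

(* In a flat chart, add to the last piece of the arc a linear ramp along the
   leaves that ends at [y' - y]: the transverse velocity is unchanged. *)
Lemma slide_arc x y y' c : flat_chart (leaf F) c -> dom c y -> dom c y' ->
  rsubmx (cmap c y) = rsubmx (cmap c y') ->
  causal_arc T x y -> causal_chain T x y'.
Proof.
move=> fc cy cy' yy' [gam [s [t [st arc gs gt]]]]; have ac : atlas c by case: fc.
pose h := cmap c y' - cmap c y.
have h0 : rsubmx h = 0 by rewrite /h linearB /= yy' subrr.
have [U [del [oU sU [cdel sdel] gE w]]] := arc.
have tI : t \in `[s, t] by rewrite in_itv /= lexx ltW.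
have deltE : del t = y by rewrite -gE.
pose I := cmap c @` dom c.
have oI : open I by exact: image_open.
(* [U1] asks for room for the full displacement [h]; by convexity of the box there is then room for
   every fraction of it. *)
pose U1 := [set u | [/\ U u, dom c (del u) & I (cmap c (del u) + h)]].
have [r r0 rU1] : exists2 r, 0 < r & ball t r `<=` U1.
  have Ut : U t by exact: sU.
  have ct : dom c (del t) by rewrite deltE.
  suff /nbhs_ballP[r r0 rU] : nbhs t U1 by exists r.
  have n1 : \forall u \near t, U u by exact: open_nbhs_nbhs.
  have n2 : \forall u \near t, dom c (del u).
    by apply: (cdel _ Ut); apply: open_nbhs_nbhs; split=> //; exact: dom_open.
  have n3 : \forall u \near t, I (cmap c (del u) + h).
    have cc : {for t, continuous (fun u => cmap c (del u) + h)}.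
      apply: continuousD; last exact: cst_continuous.
      by apply: continuous_comp; [exact: cdel|exact: cmap_cont].
    apply: cc; apply: open_nbhs_nbhs; split=> //.
    by rewrite deltE /h addrC subrK; exists y'.
  by near=> u; split; near: u.
(* The midpoint keeps [s'] strictly after [s]; the other bound puts the whole of [[s', t]] in the
   ball of radius [r]. *)
pose s' := Num.max ((s + t) / 2) (t - r / 2).
have ss' : s < s' by rewrite lt_max midf_lt.
have s't : s' < t.
  by rewrite gt_max midf_lt//= ltrBlDr ltrDl divr_gt0.
have s'r u : u \in `[s', t] -> ball t r u.
  rewrite in_itv /= ge_max => /andP[/andP[_ ru] ut].
  rewrite -ball_normE /= ger0_norm ?subr_ge0//.
  by move: ru; lra.
(* Slope and offset of the affine ramp that is [0] at [s'] and [h] at [t]. *)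
pose h1 := (t - s')^-1 *: h; pose z1 := - (s' *: h1).
have ramp u : z1 + u *: h1 = ((u - s') / (t - s')) *: h.
  by rewrite /z1 /h1 !scalerA addrC -scalerBl mulrBl.
have h10 : rsubmx h1 = 0 by rewrite linearZ /= h0 scaler0.
have z10 : rsubmx z1 = 0 by rewrite linearN linearZ /= h10 scaler0 oppr0.
have ts' : t - s' != 0 by rewrite subr_eq0 gt_eqF.
have gap : 0 < t - s' by rewrite subr_gt0.
pose k u := cmap c (del u) + (z1 + u *: h1).
(* An arc must be smooth on an open neighborhood of its interval, so the ramp is also allowed to run
   slightly past [s'] and [t]. *)
pose U2 := [set u | [/\ U u, dom c (del u) & I (k u)]].
have oU2 : open U2.
  rewrite openE => u [Uu cu Iu].
  have n1 : \forall v \near u, U v by exact: open_nbhs_nbhs.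
  have n2 : \forall v \near u, dom c (del v).
    by apply: (cdel _ Uu); apply: open_nbhs_nbhs; split=> //; exact: dom_open.
  have n3 : \forall v \near u, I (k v).
    have cc : {for u, continuous k}.
      apply: continuousD; last exact: line_continuous.
      by apply: continuous_comp; [exact: cdel|exact: cmap_cont].
    by apply: cc; exact: open_nbhs_nbhs.
  by near=> v; split; near: v.
have sU2 : `[s', t] `<=` U2.
  move=> u uI; have [Uu cu Iu] := rU1 _ (s'r _ uI).
  split=> //; rewrite /k ramp; apply: (flat_convex fc) => //.
  move: uI; rewrite /= !in_itv /= => /andP[s'u ut].
  by rewrite divr_ge0 ?subr_ge0 ?(ltW s't)// ler_pdivrMr// mul1r lerD2r.
have sc2 : smooth_curve U2 del.
  split=> [u [Uu _ _]|d ad j]; first exact: cdel.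
  by apply: Ck_sub (sdel d ad j) => u [[]].
have [sdel' w'] := @add_vertical_ramp U2 del c z1 h1 fc z10 h10 oU2 sc2
  (fun u '(And3 _ cu _) => cu) (fun u '(And3 _ _ Iu) => Iu).
pose del' u := cinv c (k u).
have d's : del' s' = del s'.
  rewrite /del' /k ramp subrr mul0r scale0r addr0 cmapK//.
  by have [] := sU2 s'; rewrite //= in_itv /= lexx ltW.
have d't : del' t = y'.
  by rewrite /del' /k ramp divff// scale1r deltE /h addrC subrK cmapK.
have ssub : `[s, s'] `<=` `[s, t].
  move=> u /=; rewrite !in_itv /= => /andP[-> us] /=.
  exact: le_trans us (ltW s't).
have s'sub : `[s', t] `<=` `[s, t].
  move=> u /=; rewrite !in_itv /= => /andP[su ->]; rewrite andbT.
  exact: le_trans (ltW ss') su.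
(* The velocity may jump at [s'], where the ramp begins: the result is two arcs, the old one up to
   [s'] and the ramped one after it. *)
apply: (@chain_cons _ _ _ _ _ _ T x (del s')).
  exists gam, s, s'; split=> //; first exact: sub_future_causal_arc arc.
  by rewrite gE// ssub//= in_itv /= lexx ltW.
apply: chain_arc; exists del', s', t; split=> //.
exists U2, del'; split=> // u d uI ad du.
apply: w' => //; first exact: sU2.
by move=> d' ad' d'u; apply: w => //; exact: s'sub.
Unshelve. all: by end_near. Qed.

Lemma slide_chain x y y' c : flat_chart (leaf F) c -> dom c y -> dom c y' ->
  rsubmx (cmap c y) = rsubmx (cmap c y') ->
  causal_chain T x y -> causal_chain T x y'.
Proof.
move=> fc + cy' + xy; elim: xy => {x y} [x y xy cy yy'|x z y xz _ IH cy yy'].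
  exact: slide_arc fc cy cy' yy' xy.
by apply: chain_cons xz _; exact: IH.
Qed.

(** Nearby points of the leaf, in its own topology, share a plaque, so being reachable from [x] is a
    locally constant proposition on the connected parameter manifold of the leaf. *)
Lemma slide_leaf x y y' : leaf F y y' ->
  causal_chain T x y -> causal_chain T x y'.
Proof.
move=> lyy' xy.
have [N [f fP]] := leaf_immersed F y.
have [cN _ _ fL] := fP.
have ex z : leaf F y z -> exists a, f a = z.
  move=> yz; have : range f z by rewrite fL.
  by move=> [a _ fa]; exists a.
have [a fa] : exists a, f a = y by apply: ex; exact: generic_quotient.equiv_refl.
have [a' fa'] := ex _ lyy'.
suff : causal_chain T x (f a') = causal_chain T x (f a) by rewrite fa fa' => ->.
apply: (@connected_locally_constant N _ setT (fun b => causal_chain T x (f b))) => //.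
move=> b _; have [c fc cb] := leaf_flat F (f b).
apply: filterS (param_plaque fP fc cb) => b' [cb' bb'] _.
apply/propext; split; first exact: (slide_chain fc cb' cb bb').
exact: (slide_chain fc cb cb' (esym bb')).
Qed.

Lemma leaf_lt_trans (L L' L'' : leaf_space F) :
  leaf_lt T L L' -> leaf_lt T L' L'' -> leaf_lt T L L''.
Proof.
move=> [gam [a [b [C1 <- <-]]]] [gam' [a' [b' [C2 E <-]]]].
(* Equality in the quotient says that the first curve ends on the leaf where the second starts;
   sliding its end point along that leaf lets the two be joined. *)
have /eqmodP lE : leaf_of F (gam b) = leaf_of F (gam' a') by rewrite E.
have ch := causal_chain_trans (slide_leaf lE (chain_of_curve C1)) (chain_of_curve C2).
have [k [s [t [C ks kt]]]] := curve_of_chain ch.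
by exists k, s, t; rewrite ks kt.
Qed.

Lemma Jplus_trans : transitive_rel (Jplus T).
Proof.
move=> x y z [/= xy|/= ->] [/= yz|/= <-]; [left|by left|by left|by right].
exact: leaf_lt_trans yz.
Qed.

End slide.

(** * The Seifert relation and its comparison with the [K^+] relation *)

Section seifert.
Variables (R : realType) (p q : nat) (M : smooth_manifold R (p + q)).
Variables (F : foliation M) (g : transverse_metric F) (T : time_orientation g).

Lemma wider_leaf_lt (g' : transverse_metric F) (T' : time_orientation g') :
  wider_orientation T T' ->
  forall L L' : leaf_space F, leaf_lt T L L' -> leaf_lt T' L L'.
Proof.
move=> TT' L L' [gam [a [b [[ab cg [s [ps sb arcs]]] ga gb]]]].
exists gam, a, b; split=> //; split=> //; exists s; split=> // i si.
have [U [del [oU sU sc gE w]]] := arcs i si.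
by exists U, del; split=> // u c uI ac cu; apply: TT' => //; exact: w.
Qed.

Lemma Jplus_sub_Jseifert : Jplus T `<=` Jseifert T.
Proof.
move=> LL [lt|eq] g' T' _ TT'; [left|by right].
exact: wider_leaf_lt lt.
Qed.

Lemma Jseifert_trans : transitive_rel (Jseifert T).
Proof.
move=> x y z xy yz g' T' gg' TT'.
exact: (Jplus_trans (xy _ _ gg' TT') (yz _ _ gg' TT')).
Qed.

Lemma stably_causal_antisymmetric :
  stably_causal T -> antisymmetric_rel (Jseifert T).
Proof.
move=> [g' [T' [gg' TT' cT']]] x y xy yx.
have [/= lxy|//] := xy _ _ gg' TT'.
have [/= lyx|//] := yx _ _ gg' TT'.
by have := cT' x (leaf_lt_trans lxy lyx).
Qed.

End seifert.

Theorem proposition7p1 (R : realType) (p q : nat)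
    (M : smooth_manifold R (p + q)) (F : foliation M)
    (g : transverse_metric F) (T : time_orientation g)
    (hn : (3 <= p + q)%N) (hq : (2 <= q)%N) (hM : connected [set: M]) :
  (seifert_condition T -> closed (Jseifert T) -> K_causal T) /\
  (stably_causal T -> antisymmetric_rel (Jseifert T) /\ seifert_condition T).
Proof.
split=> [sc cJ x y xy yx|sT].
  (* Being closed, transitive and containing [Jplus T], the Seifert relation is one of the relations
     intersected in [Kplus T]. *)
  have KJ : Kplus T `<=` Jseifert T.
    apply: bigcap_inf; split=> //; first exact: Jseifert_trans.
    exact: Jplus_sub_Jseifert.
  by apply: sc; exact: KJ.
have anti := stably_causal_antisymmetric sT.
(* Antisymmetry places the pair on the diagonal itself, which its closure contains. *)
split=> // x y xy yx; apply: subset_closure; exact: anti.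
Qed.
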